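(* Let $H$ be a finitely generated $\mathbb{Z}[t^{\pm1}]$-module such that multiplication by $t-1$ is an isomorphism $H\to H$, and let $n$ be a positive integer. Then the following hold: (i) If $\chi:H\to\mathbb{C}^*$ is a character of order $n$, then $\alpha_\chi$ defines an irreducible $\mathrm{SL}(n,\mathbb{C})$ representation of $\mathbb{Z}\ltimes H$. (ii) Given two characters $\chi_1,\chi_2:H\to\mathbb{C}^*$ of order $n$, the representations $\alpha_{\chi_1}$ and $\alpha_{\chi_2}$ are conjugate if and only if $\chi_1=t^k\chi_2$ for some integer $k$. (iii) For any irreducible representation $\alpha:\mathbb{Z}\ltimes H\to\mathrm{SL}(n,\mathbb{C})$ there exists a character $\chi:H\to\mathbb{C}^*$ of order $n$ such that $\alpha$ is conjugate to $\alpha_\chi$.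
   Context: $\mathbb{Z}\ltimes H$ is the set $\mathbb{Z}\times H$ with group law $(j_1,h_1)(j_2,h_2)=(j_1+j_2,\,t^{j_2}h_1+h_2)$. A character of $H$ is a group homomorphism $\chi:H\to\mathbb{C}^*=\mathbb{C}\setminus\{0\}$; it has order $k$ if $k=\min\{\ell\ge1\mid \chi\text{ factors through }H/(t^\ell-1)\}$, where $H/(t^\ell-1)=H/(t^\ell-1)H$. The character $t^i\chi$ is defined by $(t^i\chi)(h)=\chi(t^ih)$. For a character $\chi$ of order $n$, and $(j,h)\in\mathbb{Z}\ltimes H$, put $$\alpha_\chi(j,h)=M^{\,j}\cdot\operatorname{diag}(\chi(h),\chi(th),\dots,\chi(t^{n-1}h)),$$ where $M$ is the $n\times n$ matrix with $Me_i=e_{i+1}$ for $1\le i<n$ and $Me_n=(-1)^{n+1}e_1$ (so $M=(1)$ if $n=1$). *)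

(* Defs.v *)
From HB Require Import structures.
From mathcomp Require Import all_boot all_order all_algebra.
From mathcomp Require Import complex boolp reals.

Set Implicit Arguments.
Unset Strict Implicit.
Unset Printing Implicit Defensive.

Import GRing.Theory.
Local Open Scope ring_scope.
Local Open Scope quotient_scope.

Local Notation "p %:F" := (@tofrac _ p).

(** The ring Z[t, t^-1], realised as the subring of the field of fractions of
    Z[t] made of the fractions whose denominator is a power of t. *)
Definition is_laurent : pred {fraction {poly int}} :=
  [pred x | `[< exists (p : {poly int}) (n : nat),
                  x = p%:F / ('X%:F : {fraction {poly int}}) ^+ n >]].

Fact is_laurent_subring : subring_closed is_laurent.
Proof.
have X0 : ('X%:F : {fraction {poly int}}) != 0 by rewrite tofrac_eq0 polyX_eq0.
split=> [|x y /asboolP [p [m ->]] /asboolP [q [n ->]]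
         |x y /asboolP [p [m ->]] /asboolP [q [n ->]]]; apply/asboolP.
- by exists 1, 0%N; rewrite rmorph1 expr0 invr1 mulr1.
- exists (p * 'X^n - q * 'X^m), (m + n)%N.
  rewrite rmorphB !rmorphM !rmorphXn /= exprD mulrBl; congr (_ - _).
    by rewrite -mulf_div divff ?expf_neq0 // mulr1.
  by rewrite ['X%:F ^+ m * _]mulrC -mulf_div divff ?expf_neq0 // mulr1.
- exists (p * q), (m + n)%N.
  by rewrite rmorphM exprD invfM mulrACA.
Qed.

HB.instance Definition _ :=
  GRing.isSubringClosed.Build {fraction {poly int}} is_laurent is_laurent_subring.

Record laurent := Laurent {
  laurent_val : {fraction {poly int}};
  laurent_valP : laurent_val \in is_laurent }.

HB.instance Definition _ := [isSub for laurent_val].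
HB.instance Definition _ := [Choice of laurent by <:].
HB.instance Definition _ := [SubChoice_isSubComNzRing of laurent by <:].

Definition laurent_unit : pred laurent :=
  [pred x | (val x != 0) && ((val x)^-1 \in is_laurent)].
Definition laurent_inv (x : laurent) : laurent :=
  if laurent_unit x then insubd x (val x)^-1 else x.

Fact laurent_mulVr : {in laurent_unit, left_inverse 1 laurent_inv *%R}.
Proof.
move=> x xU; apply: val_inj; rewrite /laurent_inv.
have -> : laurent_unit x by [].
by case/andP: xU => x0 xV; rewrite rmorphM /= insubdK // mulVf.
Qed.

Fact laurent_unitP (x y : laurent) : y * x = 1 -> x \in laurent_unit.
Proof.
move=> /(congr1 val); rewrite rmorphM rmorph1 /= => yx1.
have x0 : val x != 0.
  by apply/eqP => x0; move/eqP: yx1; rewrite /= x0 mulr0 eq_sym oner_eq0.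
apply/andP; split=> //.
have -> : (val x)^-1 = val y by apply: (mulIf x0); rewrite mulVf.
exact: (valP y).
Qed.

Fact laurent_inv_out : {in [predC laurent_unit], laurent_inv =1 id}.
Proof. by move=> x xN; rewrite /laurent_inv ifN. Qed.

HB.instance Definition _ := GRing.ComNzRing_hasMulInverse.Build laurent
  laurent_mulVr laurent_unitP laurent_inv_out.

Fact laurent_X : ('X%:F : {fraction {poly int}}) \in is_laurent.
Proof. by apply/asboolP; exists 'X, 0%N; rewrite expr0 invr1 mulr1. Qed.

Definition laurentX : laurent := Laurent laurent_X.
Local Notation t := laurentX.

Fact unit_laurentX : t \is a GRing.unit.
Proof.
have X0 : ('X%:F : {fraction {poly int}}) != 0 by rewrite tofrac_eq0 polyX_eq0.
apply/andP; split=> //.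
by apply/asboolP; exists 1, 1%N; rewrite rmorph1 expr1 mul1r.
Qed.

Definition finitely_generated (A : nzRingType) (V : lmodType A) : Prop :=
  exists (m : nat) (g : 'I_m -> V),
    forall v : V, exists c : 'I_m -> A, v = \sum_(i < m) c i *: g i.

Section SemidirectProduct.
Variable H : lmodType laurent.

Definition ZltimesH : Type := (int * H)%type.

HB.instance Definition _ := Choice.on ZltimesH.

Definition sd_mul (x y : ZltimesH) : ZltimesH :=
  (x.1 + y.1, t ^ y.1 *: x.2 + y.2).
Definition sd_one : ZltimesH := (0, 0).
Definition sd_inv (x : ZltimesH) : ZltimesH := (- x.1, - (t ^ (- x.1) *: x.2)).

Fact sd_mulA : associative sd_mul.
Proof.
move=> [i x] [j y] [k z]; rewrite /sd_mul /= addrA; congr (_, _).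
by rewrite scalerDr scalerA addrA -exprzDr ?unit_laurentX // [k + j]addrC.
Qed.
Fact sd_mul1 : left_id sd_one sd_mul.
Proof. by move=> [i x]; rewrite /sd_mul /= add0r scaler0 add0r. Qed.
Fact sd_mulr1 : right_id sd_one sd_mul.
Proof. by move=> [i x]; rewrite /sd_mul /= !addr0 expr0z scale1r. Qed.
Fact sd_mulV : left_inverse sd_one sd_inv sd_mul.
Proof.
move=> [i x]; rewrite /sd_mul /sd_inv /= addNr; congr (_, _).
by rewrite scalerN scalerA -exprzDr ?unit_laurentX // subrr expr0z scale1r addNr.
Qed.
Fact sd_mulrV : right_inverse sd_one sd_inv sd_mul.
Proof. by move=> [i x]; rewrite /sd_mul /sd_inv /= !subrr. Qed.

HB.instance Definition _ :=
  isGroup.Build ZltimesH sd_mulA sd_mul1 sd_mulr1 sd_mulV sd_mulrV.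
End SemidirectProduct.

Section SubmoduleTl1.
Variable H : lmodType laurent.

(** the submodule (t^l - 1)H *)
Definition sub_tl1 (l : nat) : pred H :=
  [pred h | `[< exists x : H, h = (t ^+ l - 1) *: x >]].

Fact sub_tl1_zmod (l : nat) : zmod_closed (sub_tl1 l).
Proof.
split=> [|x y /asboolP [u ->] /asboolP [v ->]]; apply/asboolP.
  by exists 0; rewrite scaler0.
by exists (u - v); rewrite scalerBr.
Qed.

HB.instance Definition _ (l : nat) :=
  GRing.isZmodClosed.Build H (sub_tl1 l) (sub_tl1_zmod l).
End SubmoduleTl1.

(** the quotient group H / (t^l - 1)H *)
Notation Hquot H l :=
  (Quotient.quot (GRing.ZmodClosed.clone H (@sub_tl1 H l) _)) (only parsing).

Section Characters.
Variables (R : realType) (H : lmodType laurent).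

Definition is_character (V : zmodType) (chi : V -> R[i]) : Prop :=
  (forall x, chi x != 0) /\ (forall x y, chi (x + y) = chi x * chi y).

Definition factors_through (l : nat) (chi : H -> R[i]) : Prop :=
  exists psi : Hquot H l -> R[i],
    is_character psi /\ forall h, chi h = psi (\pi_(Hquot H l) h).

Definition has_order (chi : H -> R[i]) (k : nat) : Prop :=
  [/\ (0 < k)%N, factors_through k chi
    & forall l : nat, (0 < l)%N -> factors_through l chi -> (k <= l)%N].

Definition char_shift (i : int) (chi : H -> R[i]) : H -> R[i] :=
  fun h => chi (t ^ i *: h).

End Characters.

Section Representations.
Variables (R : realType) (n : nat).

(** The identity rho 1 = 1 follows, as every rho g is invertible. *)
Definition is_SLrep (G : groupType) (rho : G -> 'M[R[i]]_n) : Prop :=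
  (forall g, \det (rho g) = 1) /\
  (forall g h, rho (g * h)%g = rho g *m rho h).

(** Matrices act on column vectors from the left. *)
Definition irreducible_rep (G : groupType) (rho : G -> 'M[R[i]]_n) : Prop :=
  (0 < n)%N /\
  forall U : {vspace 'cV[R[i]]_n},
    (forall g v, v \in U -> rho g *m v \in U) -> U = 0%VS \/ U = fullv.

Definition conjugate_rep (G : groupType) (rho sigma : G -> 'M[R[i]]_n) : Prop :=
  exists2 P : 'M[R[i]]_n, P \in unitmx &
    forall g, rho g = P *m sigma g *m invmx P.

Definition mxpowz (A : 'M[R[i]]_n) (j : int) : 'M[R[i]]_n :=
  match j with
  | Posz k => A ^+ k
  | Negz k => invmx A ^+ k.+1
  end.

(** With indices starting from 0: column j is e_(j+1) if j < n - 1, and the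
    last column is (-1)^(n+1) e_0. *)
Definition cyclic_mx : 'M[R[i]]_n :=
  \matrix_(i < n, j < n)
    if (j.+1 < n)%N then (i == j.+1 :> nat)%:R
    else (-1) ^+ n.+1 * (i == 0%N :> nat)%:R.

Definition alpha (H : lmodType laurent) (chi : H -> R[i]) (g : ZltimesH H) :
    'M[R[i]]_n :=
  mxpowz cyclic_mx g.1 *m diag_mx (\row_(i < n) chi (t ^+ i *: g.2)).

End Representations.

(* Main.v *)
(** A representation of Z |x H is determined by T = rho(1,0) and the commuting
    matrices rho(0,h), and T permutes the weight spaces of H by chi |-> t chi.
    When chi has order n the weights chi, t chi, ..., t^(n-1) chi are distinct,
    so every H-stable subspace of C^n contains a basis vector and, cycling with
    M, is everything; and the weights of alpha_chi recover the t-orbit of chi.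
    The determinant of diag(chi(t^i h)) is chi((1 + t + ... + t^(n-1)) h); writing
    h = (t - 1) h' turns it into chi((t^n - 1) h') = 1.

    Conversely, let chi be a weight of an irreducible rho. Vectors of distinct
    weights are independent, so chi has some finite order k, and T^k preserves the
    weight space of chi. For an eigenvector w of T^k in that space, with eigenvalue
    c, the vectors w, Tw, ..., T^(k-1) w are independent and span a subrepresentation,
    so they form a basis of C^n and k = n. In this basis rho is alpha_chi with M
    replaced by the cyclic matrix whose last column is c e_1, and det T = 1 forces
    c = (-1)^(n+1). *)

Require Import Defs.
From HB Require Import structures.
From mathcomp Require Import all_boot all_order all_algebra.
From mathcomp Require Import complex boolp reals.

Set Implicit Arguments.
Unset Strict Implicit.
Unset Printing Implicit Defensive.

Import GRing.Theory.
Local Open Scope ring_scope.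
Local Open Scope quotient_scope.

(** * Eigenvectors and joint eigenvectors *)

(* The subspace is a Prop-valued predicate so that it can be a weight space, the
   intersection of an infinite family of eigenspaces. *)
Lemma stable_eigenvector (F : closedFieldType) n (A : 'M[F]_n)
    (P : 'cV[F]_n -> Prop) (v : 'cV[F]_n) :
    (forall a u w, P u -> P w -> P (a *: u + w)) ->
    (forall u, P u -> P (A *m u)) -> P v -> v != 0 ->
  exists a w, [/\ P w, w != 0 & A *m w = a *: w].
Proof.
case: n A P v => [|n] A P v Plin PA Pv v0; first by rewrite flatmx0 eqxx in v0.
have [s Ds] := closed_field_poly_normal (char_poly A).
have := Cayley_Hamilton A; rewrite Ds (monicP (char_poly_monic A)) scale1r.
rewrite rmorph_prod /= => /(congr1 (mulmxr v)) /=; rewrite mul0mx.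
have -> : \prod_(a <- s) horner_mx A ('X - a%:P) = \prod_(a <- s) (A - a%:M).
  by apply: eq_bigr => a _; rewrite rmorphB /= horner_mx_X horner_mx_C.
(* The factors [A - a%:M] are applied to [v] one at a time, rightmost first; the last nonzero vector
   before 0 appears is an eigenvector. Reversing the list makes the induction expose the rightmost
   factor. *)
rewrite -(revK s); elim: (rev s) v Pv v0 => {Ds s} [|a s IHs] v Pv v0.
  by rewrite big_nil mul1mx => v00; rewrite v00 eqxx in v0.
rewrite rev_cons -cats1 big_cat big_seq1 /= -mulmxA.
have [/eqP|w0] := eqVneq ((A - a%:M) *m v) 0.
  by rewrite mulmxBl mul_scalar_mx subr_eq0 => /eqP Av _; exists a, v.
apply: IHs w0; rewrite mulmxBl mul_scalar_mx addrC -scaleNr.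
exact: Plin (PA _ Pv).
Qed.

(** The family may be infinite, so the induction is on the dimension of a nonzero common invariant
    subspace [U]. If some [A i] is not scalar on [U], commutativity makes one of its eigenspaces in
    [U] a smaller such subspace. *)
Lemma commuting_family_eigenvector (F : closedFieldType) n (I : Type)
    (A : I -> 'M[F]_n) :
    (0 < n)%N -> (forall i j, A i *m A j = A j *m A i) ->
  exists2 v : 'cV[F]_n, v != 0 & forall i, exists a, A i *m v = a *: v.
Proof.
move=> n_gt0 Acomm.
have [U] : exists U : {vspace 'cV[F]_n},
    U != 0%VS /\ forall i u, u \in U -> A i *m u \in U.
  exists fullv; split=> [|i u _]; last exact: memvf.
  by rewrite -dimv_eq0 dimvf /dim /= muln1 -lt0n.
move: {2}(\dim U) (leqnn (\dim U)) => d.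
elim: d U => [|d IHd] U leUd [U0 UA].
  by move: leUd; rewrite leqn0 dimv_eq0 (negPf U0).
have [scal|] := pselect (forall i, exists a, forall u, u \in U -> A i *m u = a *: u).
  exists (vpick U); first by rewrite vpick0.
  by move=> i; have [a Aa] := scal i; exists a; apply: Aa; apply: memv_pick.
move=> /existsNP[i /forallNP notscal].
have [a [w [Uw w0 Aw]]] : exists a w, [/\ w \in U, w != 0 & A i *m w = a *: w].
  apply: (@stable_eigenvector _ _ _ _ (vpick U)); rewrite ?memv_pick ?vpick0 //.
    by move=> a u w Uu Uw; rewrite memvD // memvZ.
  exact: UA.
pose W := (U :&: lker (linfun (mulmx (A i - a%:M))))%VS.
have memW u : (u \in W) = (u \in U) && (A i *m u == a *: u).
  by rewrite memv_cap memv_ker lfunE /= mulmxBl mul_scalar_mx subr_eq0.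
apply: (IHd W).
  rewrite -ltnS; apply: leq_trans leUd.
  rewrite ltn_neqAle (dimv_leqif_eq (capvSl _ _)) dimvS ?capvSl // andbT.
  apply/eqP => WU; apply: (notscal a) => u; rewrite -WU memW.
  by case/andP=> _ /eqP.
split.
  apply: contraNneq w0 => W0; have: w \in W by rewrite memW Uw Aw eqxx.
  by rewrite W0 memv0.
move=> j u; rewrite !memW => /andP[Uu /eqP Au]; rewrite UA //=.
by rewrite mulmxA Acomm -mulmxA Au -scalemxAr.
Qed.

(** Induction on the size of the support of [v]. If [v] is nonzero at [i] and [j], and
    [chi i h != chi j h], then applying the diagonal matrix of [h] minus the scalar [chi i h] kills
    coordinate [i], keeps [j] and creates no new nonzero coordinate. *)
Lemma diag_stable_delta (F : fieldType) r (I : Type) (chi : 'I_r -> I -> F)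
    (P : 'cV[F]_r -> Prop) (v : 'cV[F]_r) :
    injective chi -> (forall a u w, P u -> P w -> P (a *: u + w)) ->
    (forall h u, P u -> P (diag_mx (\row_i chi i h) *m u)) -> P v -> v != 0 ->
  exists i, P (delta_mx i 0).
Proof.
move=> chi_inj Plin PD.
have [d] := ubnP #|[set i | v i 0 != 0]|.
elim: d v => // d IHd v /ltnSE led Pv v0.
have [i vi] : exists i, v i 0 != 0 by apply/cV0Pn.
have [[j vj ij]|onlyi] := pselect (exists2 j, v j 0 != 0 & i != j); last first.
  exists i; have P0 : P 0 by rewrite -(addNr v) -scaleN1r; apply: Plin.
  suff -> : delta_mx i 0 = (v i 0)^-1 *: v + 0 by apply: Plin.
  rewrite addr0; apply/colP => k; rewrite !mxE eqxx andbT.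
  have [->|ki] := eqVneq k i; first by rewrite mulVf.
  have [->|vk] := eqVneq (v k 0) 0; first by rewrite mulr0.
  by case: onlyi; exists k; rewrite // eq_sym.
have [h hij] : exists h, chi i h != chi j h.
  apply: contrapT => /forallNP nh; case/eqP: ij; apply: chi_inj; apply: funext => h.
  by apply/eqP; apply: contrapT => /negP; apply: nh.
pose w := (- chi i h) *: v + diag_mx (\row_i chi i h) *m v.
have wE k : w k 0 = (chi k h - chi i h) * v k 0.
  by rewrite /w mul_diag_mx !mxE mulNr addrC mulrBl.
apply: (IHd w).
- apply: leq_trans led; apply: proper_card; apply/properP; split.
    by apply/subsetP=> k; rewrite !inE wE mulf_eq0 negb_or => /andP[].
  by exists i; rewrite !inE ?wE ?subrr ?mul0r ?eqxx.
- exact: Plin (PD _ _ Pv).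
- apply/cV0Pn; exists j; rewrite wE mulf_neq0 // subr_eq0.
  by rewrite eq_sym.
Qed.

(** The kernel of [V] is stable under the diagonal matrices, so if it were nonzero it would contain
    a basis vector by [diag_stable_delta], and a column of [V] would vanish. *)
Lemma eigenvectors_free (F : fieldType) n r (I : Type) (chi : 'I_r -> I -> F)
    (A : I -> 'M[F]_n) (V : 'M[F]_(n, r)) :
    injective chi -> (forall h, A h *m V = V *m diag_mx (\row_i chi i h)) ->
    (forall i, col i V != 0) ->
  row_free V^T.
Proof.
move=> chi_inj AV V0; apply: inj_row_free => c cV.
apply: contraTeq isT => c0.
have [||||i] := @diag_stable_delta F r I chi (fun u => V *m u = 0) c^T chi_inj.
- by move=> a u w Vu Vw; rewrite mulmxDr -scalemxAr Vu Vw scaler0 addr0.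
- by move=> h u Vu; rewrite mulmxA -AV -mulmxA Vu mulmx0.
- by rewrite -[V]trmxK -trmx_mul cV trmx0.
- by apply: contraNneq c0 => /(congr1 trmx); rewrite trmxK trmx0 => ->.
by rewrite -colE => /eqP; rewrite (negPf (V0 i)).
Qed.

(** * Characters of [H] and their periods *)

Section Characters.
Variables (R : realType) (H : lmodType laurent).
Implicit Types chi : H -> R[i].
Local Notation t := laurentX.

Lemma character0 chi : is_character chi -> chi 0 = 1.
Proof.
move=> [chi0 chiD]; apply: (mulfI (chi0 0)).
by rewrite -chiD addr0 mulr1.
Qed.

Lemma factors_throughP chi l : is_character chi ->
  factors_through l chi <-> forall h, chi (t ^+ l *: h) = chi h.
Proof.
move=> chiC; have [chi_n0 chiD] := chiC.
split=> [[psi [_ chiE]] h|chit].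
  rewrite !chiE; congr (psi _); apply/eqquotP; rewrite Quotient.equivE.
  by apply/asboolP; exists h; rewrite scalerBl scale1r.
(* [chi] is constant on classes modulo (t^l - 1)H, so its composite with [repr] is the required
   character of the quotient. *)
have chi_repr h : chi (repr (\pi_(Hquot H l) h)) = chi h.
  have /eqquotP : repr (\pi_(Hquot H l) h) = h %[mod Hquot H l] by rewrite reprK.
  rewrite Quotient.equivE => /asboolP[x].
  rewrite scalerBl scale1r => /(canRL (subrK _)) ->.
  apply: (mulIf (chi_n0 x)).
  by rewrite -chiD addrAC subrK chiD chit mulrC.
exists (fun x => chi (repr x)); split=> [|h]; last exact/esym/chi_repr.
split=> // x y.
by rewrite -{1}[x]reprK -{1}[y]reprK -raddfD chi_repr chiD.
Qed.

Lemma scale_exprz_laurentX i j (h : H) : t ^ i *: (t ^ j *: h) = t ^ (i + j) *: h.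
Proof. by rewrite scalerA -exprzDr ?unit_laurentX. Qed.

(** If t^i chi = t^j chi with i < j, evaluating at t^(-i) h gives chi the period j - i < k. Only
    periods below [k] are excluded, so the lemma also applies before chi is known to have finite
    order. *)
Lemma shift_inj chi k : is_character chi ->
  (forall l, (0 < l < k)%N -> ~ factors_through l chi) ->
  injective (fun (i : 'I_k) h => chi (t ^+ i *: h)).
Proof.
move=> chiC nfact i j eqf; have {eqf} eqij h := congr1 (@^~ h) eqf.
wlog ltij : i j eqij / (i < j)%N => [wl|].
  case: (ltngtP i j) => [ij|ji|/val_inj //]; first exact: wl.
  by apply/esym/wl => // h; rewrite eqij.
case: (nfact (j - i)%N); first by rewrite subn_gt0 ltij (leq_ltn_trans (leq_subr _ _)).
apply/factors_throughP => // h.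
have := eqij (t ^ (- i%:Z) *: h).
by rewrite !exprnP !scale_exprz_laurentX addrN expr0z scale1r subzn // ltnW.
Qed.

End Characters.

(** * Integer powers of matrices and cyclic matrices *)

(** [V] may be rectangular, so negative powers come from cancelling a power of [A] on the left and
    of [B] on the right, not from conjugation. *)
Lemma intertwine_exprz (F : fieldType) n k (A : 'M[F]_n.+1) (B : 'M[F]_k.+1)
    (V : 'M[F]_(n.+1, k.+1)) (z : int) :
  A \is a GRing.unit -> B \is a GRing.unit -> A *m V = V *m B ->
  A ^ z *m V = V *m B ^ z.
Proof.
move=> uA uB AV.
have AVn i : A ^+ i *m V = V *m B ^+ i.
  elim: i => [|i IHi]; first by rewrite !expr0 mul1mx mulmx1.
  by rewrite !exprS -!mulmxE -mulmxA IHi !mulmxA AV.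
case: z => i; first exact: AVn.
rewrite !NegzE -!exprnN.
have uAi : A ^+ i.+1 \in unitmx by exact: unitrX.
have uBi : B ^+ i.+1 \in unitmx by exact: unitrX.
by apply: (can_inj (mulKmx uAi)); rewrite mulKVmx // mulmxA AVn mulmxK.
Qed.

Lemma det_exprz (F : fieldType) n (A : 'M[F]_n.+1) (z : int) :
  \det A = 1 -> \det (A ^ z) = 1.
Proof.
move=> dA; have dX i : \det (A ^+ i) = 1.
  by elim: i => [|i IHi]; rewrite ?expr0 ?det1 // exprS det_mulmx dA IHi mulr1.
by case: z => i; rewrite ?NegzE -?exprnN ?det_inv dX ?invr1.
Qed.

Section CycleMatrix.
Variables (F : fieldType) (m : nat) (c : F).

(** The companion matrix of X^(m+1) - c. The corner [c] is left free because in the classification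
    it first appears as an unknown eigenvalue. *)
Definition cycle_mx : 'M[F]_m.+1 :=
  \matrix_(i < m.+1, j < m.+1)
    if (j.+1 < m.+1)%N then (i == j.+1 :> nat)%:R else c * (i == 0%N :> nat)%:R.

Lemma det_cycle_mx : \det cycle_mx = (-1) ^+ m * c.
Proof.
rewrite (expand_det_row _ ord0) big_ord_recr big1 => [|i _] /=.
  rewrite !mxE ltnn eqxx mulr1 /cofactor add0n mulrC.
  suff -> : row' ord0 (col' ord_max cycle_mx) = 1%:M by rewrite det1 mulr1 add0r.
  by apply/matrixP => i j; rewrite !mxE lift0 lift_max ltnS ltn_ord eqSS.
by rewrite !mxE /= ltnS ltn_ord mul0r.
Qed.

Lemma cycle_mx_unit : c != 0 -> cycle_mx \is a GRing.unit.
Proof.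
by move=> c0; rewrite unitmxE det_cycle_mx unitfE mulf_neq0 // signr_eq0.
Qed.

Lemma col_mul_cycle n (V : 'M[F]_(n, m.+1)) j :
  col j (V *m cycle_mx) =
    if (j.+1 < m.+1)%N then col (inord j.+1) V else c *: col ord0 V.
Proof.
apply/colP => i; rewrite !mxE; case: ifP => jm.
  rewrite (bigD1 (inord j.+1)) //= !mxE jm inordK // eqxx mulr1 big1 ?addr0 // => k.
  by rewrite mxE jm -(inj_eq val_inj) /= inordK // => /negPf->; rewrite mulr0.
rewrite (bigD1 ord0) //= !mxE jm eqxx mulr1 mulrC big1 ?addr0 // => k k0.
by rewrite mxE jm -[(k == 0%N :> nat)]/(k == ord0) (negPf k0) !mulr0.
Qed.

Lemma cycle_mx_delta j :
  cycle_mx *m delta_mx j 0 =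
    if (j.+1 < m.+1)%N then delta_mx (inord j.+1) 0 else c *: delta_mx ord0 0
  :> 'cV_m.+1.
Proof.
by rewrite -colE -{1}[cycle_mx]mul1mx col_mul_cycle !col1.
Qed.

(** From index [i] the matrix climbs to the last basis vector and wraps to c e_0; dividing by [c]
    gives e_0, from which a second climb reaches every basis vector. *)
Lemma cycle_stable_full (U : {vspace 'cV[F]_m.+1}) (i : 'I_m.+1) :
    c != 0 -> (forall v, v \in U -> cycle_mx *m v \in U) ->
  delta_mx i 0 \in U -> U = fullv.
Proof.
move=> c0 UM Ui.
have U0 : delta_mx ord0 0 \in U.
  have [d] := ubnP (m - i)%N; elim: d i Ui => // d IHd i Ui /ltnSE lemd.
  have := UM _ Ui; rewrite cycle_mx_delta; case: ifP => [im|_]; last first.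
    by move=> /(memvZ c^-1); rewrite scalerA mulVf // scale1r.
  by move=> /IHd; apply; rewrite inordK // subnSK.
have Uall j : delta_mx j 0 \in U.
  have [k] := ubnP j; elim: k j => // k IHk [[|j] jm] /ltnSE ltj.
    by rewrite (_ : Ordinal _ = ord0) //; apply: val_inj.
  have := UM _ (IHk (Ordinal (ltnW jm)) ltj); rewrite cycle_mx_delta /= jm.
  by have -> : inord j.+1 = Ordinal jm by apply: val_inj; rewrite /= inordK.
apply/vspaceP => v; rewrite memvf [v]matrix_sum_delta.
apply: memv_suml => j _; apply: memv_suml => k _.
by rewrite (ord1 k) memvZ.
Qed.

End CycleMatrix.

Lemma power_cols_cycle (F : fieldType) n k (A : 'M[F]_n.+1) (w : 'cV_n.+1) c :
    A ^+ k.+1 *m w = c *: w ->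
  A *m (\matrix_(i < n.+1, j < k.+1) (A ^+ j *m w) i 0) =
  (\matrix_(i < n.+1, j < k.+1) (A ^+ j *m w) i 0) *m cycle_mx k c.
Proof.
move=> Aw; set V := \matrix_(i, j) _.
have colV j : col j V = A ^+ j *m w by apply/colP => i; rewrite !mxE.
apply/trmx_inj/row_matrixP => j; rewrite -!tr_col; congr (_^T).
rewrite col_mul_cycle !colV colE -mulmxA -colE colV mulmxA mulmxE -exprS.
case: ifP => jk; first by rewrite inordK.
have -> : (j.+1 = k.+1)%N by apply/eqP; rewrite eqn_leq ltn_ord leqNgt jk.
by rewrite Aw expr0 mul1mx.
Qed.

(** * The representations [alpha n chi]: determinant, irreducibility and conjugacy *)

Section CyclicRepresentation.
Variables (R : realType) (H : lmodType laurent).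
Implicit Types (chi : H -> R[i]) (h : H).
Local Notation t := laurentX.

Definition weight_mx n chi h : 'M[R[i]]_n := diag_mx (\row_i chi (t ^+ i *: h)).

Lemma mxpowzE m (A : 'M[R[i]]_m.+1) z : mxpowz A z = A ^ z.
Proof. by case: z => k //=; rewrite NegzE -exprnN -exprVn. Qed.

(** Here n = m + 1, so (-1)^(n+1) = (-1)^(m+2) = (-1)^m. *)
Lemma cyclic_mxE m : cyclic_mx R m.+1 = cycle_mx m ((-1) ^+ m).
Proof. by apply/matrixP => i j; rewrite !mxE !exprS mulrA mulrNN !mul1r. Qed.

Lemma det_cyclic_mx m : \det (cyclic_mx R m.+1) = 1.
Proof. by rewrite cyclic_mxE det_cycle_mx -expr2 sqrr_sign. Qed.

Lemma cyclic_mx_unit m : cyclic_mx R m.+1 \is a GRing.unit.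
Proof. by rewrite cyclic_mxE cycle_mx_unit // signr_eq0. Qed.

Lemma alphaE m chi g :
  alpha m.+1 chi g = cyclic_mx R m.+1 ^ g.1 *m weight_mx m.+1 chi g.2.
Proof. by rewrite /alpha mxpowzE. Qed.

Lemma weight_mxD n chi h1 h2 : is_character chi ->
  weight_mx n chi (h1 + h2) = weight_mx n chi h1 *m weight_mx n chi h2.
Proof.
case=> _ chiD; rewrite mulmx_diag; congr diag_mx; apply/rowP => i.
by rewrite !mxE scalerDr chiD.
Qed.

(** The matrix form of (0, h)(1, 0) = (1, 0)(0, th). Periodicity of [chi] is what makes the last
    column agree. *)
Lemma weight_mx_cycle m chi c h : (forall h, chi (t ^+ m.+1 *: h) = chi h) ->
  weight_mx m.+1 chi h *m cycle_mx m c = cycle_mx m c *m weight_mx m.+1 chi (t *: h).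
Proof.
move=> chit; apply/matrixP => i j; rewrite mul_diag_mx mul_mx_diag !mxE.
rewrite scalerA -exprSr [RHS]mulrC; case: ifP => jm.
  by have [->|] := eqVneq (i : nat) j.+1; rewrite ?mulr0.
have [->|] := eqVneq (i : nat) 0%N; rewrite ?mulr0 //.
have -> : (j.+1 = m.+1)%N by apply/eqP; rewrite eqn_leq ltn_ord leqNgt jm.
by rewrite chit expr0 scale1r.
Qed.

Lemma weight_mx_exprz m chi h z : (forall h, chi (t ^+ m.+1 *: h) = chi h) ->
  weight_mx m.+1 chi h *m cyclic_mx R m.+1 ^ z =
  cyclic_mx R m.+1 ^ z *m weight_mx m.+1 chi (t ^ z *: h).
Proof.
move=> chit; set M := cyclic_mx R m.+1.
have WM k h' : weight_mx m.+1 chi h' *m M ^+ k =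
               M ^+ k *m weight_mx m.+1 chi (t ^+ k *: h').
  elim: k h' => [|k IHk] h'; first by rewrite !expr0 mul1mx mulmx1 scale1r.
  rewrite exprS -!mulmxE mulmxA /M cyclic_mxE weight_mx_cycle // -cyclic_mxE -/M.
  by rewrite -!mulmxA IHk scalerA -exprSr.
case: z => k; first exact: WM.
have uM : M ^+ k.+1 \in unitmx by apply: unitrX; apply: cyclic_mx_unit.
rewrite !NegzE -!exprnN.
apply: (can_inj (mulKmx uM)); rewrite mulKVmx //.
(* Writing h as t^(k+1) (t^(-k-1) h) reduces the negative power to [WM]. *)
rewrite mulmxA -[h in LHS](scale1r) -(expr0z t) -(addrN k.+1%:Z).
rewrite -scale_exprz_laurentX -exprnP.
by rewrite -WM mulmxK.
Qed.

(** The product telescopes, each factor being chi(t^(i+1) h) / chi(t^i h); the extra factor [chi h]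
    avoids division. *)
Lemma prod_shift chi h : is_character chi -> forall n,
  \prod_(i < n) chi (t ^+ i *: ((t - 1) *: h)) * chi h = chi (t ^+ n *: h).
Proof.
move=> [_ chiD]; elim=> [|n IHn]; first by rewrite big_ord0 mul1r expr0 scale1r.
rewrite big_ord_recr /= mulrAC IHn -chiD scalerA -scalerDl.
by rewrite mulrBr mulr1 addrC subrK -exprSr.
Qed.

Lemma det_weight_mx n chi h : is_character chi ->
    bijective (fun h : H => (t - 1) *: h) ->
    (forall h, chi (t ^+ n *: h) = chi h) ->
  \det (weight_mx n chi h) = 1.
Proof.
move=> chiC [g _ gK] chit; rewrite det_diag.
have [chi0 _] := chiC; apply: (mulIf (chi0 (g h))); rewrite mul1r -[RHS]chit.
rewrite -prod_shift // gK; congr (_ * _).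
by apply: eq_bigr => i _; rewrite !mxE.
Qed.

Lemma alpha_SLrep n chi : bijective (fun h : H => (t - 1) *: h) ->
  (0 < n)%N -> is_character chi -> has_order chi n -> is_SLrep (alpha n chi).
Proof.
case: n => // m tI _ chiC [_ /factors_throughP-/(_ chiC) chit _]; split=> [g|g1 g2].
  by rewrite alphaE det_mulmx det_exprz ?det_cyclic_mx // det_weight_mx ?mulr1.
rewrite !alphaE /= weight_mxD // exprzDr ?cyclic_mx_unit // -!mulmxE.
by rewrite -!mulmxA; congr (_ *m _); rewrite !mulmxA -weight_mx_exprz.
Qed.

Lemma alpha_irreducible n chi :
  (0 < n)%N -> is_character chi -> has_order chi n -> irreducible_rep (alpha n chi).
Proof.
case: n => // m m_gt0 chiC [_ _ chi_min]; split=> // U UA.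
have [->|U0] := eqVneq U 0%VS; [by left | right].
have chi_inj : injective (fun (i : 'I_m.+1) h => chi (t ^+ i *: h)).
  apply: shift_inj => // l /andP[l_gt0 ltl] /(chi_min _ l_gt0).
  by rewrite leqNgt ltl.
have [||||i Ui] := @diag_stable_delta _ _ _ _ (fun v => v \in U) (vpick U) chi_inj.
- by move=> a u w Uu Uw; rewrite memvD // memvZ.
- by move=> h u /(UA (0, h)); rewrite alphaE mul1mx.
- exact: memv_pick.
- by rewrite vpick0.
apply: (@cycle_stable_full _ m ((-1) ^+ m) _ i _ _ Ui); first by rewrite signr_eq0.
move=> v /(UA (1, 0)); rewrite alphaE /= expr1z cyclic_mxE.
suff -> : weight_mx m.+1 chi 0 = 1%:M by rewrite mulmx1.
rewrite /weight_mx -diag_const_mx; congr diag_mx; apply/rowP => j.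
by rewrite !mxE scaler0 character0.
Qed.

Lemma alpha_conjugateP n chi1 chi2 : (0 < n)%N ->
    is_character chi1 -> has_order chi1 n ->
    is_character chi2 -> has_order chi2 n ->
  conjugate_rep (alpha n chi1) (alpha n chi2) <->
  exists k : int, chi1 = char_shift k chi2.
Proof.
case: n => // m _ chi1C chi1n chi2C [_ /factors_throughP-/(_ chi2C) chit _].
split=> [[P uP conj]|[k ->]].
  have PW h : weight_mx m.+1 chi1 h *m P = P *m weight_mx m.+1 chi2 h.
    by have := conj (0, h); rewrite !alphaE !mul1mx /= => ->; rewrite mulmxKV.
  (* A single nonzero entry in row 0 of [P] suffices: comparing the entries at (0, j) in [PW] gives
     chi1 = t^j chi2. *)
  have [j Pj] : exists j, P ord0 j != 0.
    apply: contrapT => /forallNP P0; move: uP; rewrite unitmxE (expand_det_row _ ord0).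
    rewrite big1 ?unitr0 // => j _; have /negP := P0 j.
    by rewrite negbK => /eqP->; rewrite mul0r.
  exists j%:Z; apply: funext => h.
  have := congr1 (fun A : 'M_m.+1 => A ord0 j) (PW h).
  rewrite mul_diag_mx mul_mx_diag !mxE mulrC => /(mulfI Pj).
  by rewrite expr0 scale1r.
set M := cyclic_mx R m.+1.
have uM z : M ^ z \in unitmx by apply: unitrXz; apply: cyclic_mx_unit.
have invM z : invmx (M ^ z) = M ^ (- z) by exact: invr_expz.
(* Conjugation by this power fixes the powers of [M] and replaces the diagonal at h by the one at
   t^k h. *)
exists (M ^ (- k)) => // g.
rewrite !alphaE -/M invM opprK -!mulmxA weight_mx_exprz // !mulmxA.
rewrite !mulmxE -!exprzDr ?cyclic_mx_unit // addrC addrA subrr add0r.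
congr (_ *m diag_mx _); apply/rowP => i.
by rewrite !mxE /char_shift !exprnP !scale_exprz_laurentX addrC.
Qed.

(** * Weight vectors of an arbitrary representation *)

Lemma ZltimesH_mulE z1 h1 z2 h2 :
  (((z1, h1) : ZltimesH H) * ((z2, h2) : ZltimesH H))%g = (z1 + z2, t ^ z2 *: h1 + h2).
Proof. by []. Qed.

Section WeightVectors.
Variables (m : nat) (rho : ZltimesH H -> 'M[R[i]]_m.+1).
Hypothesis rhoP : is_SLrep rho.
Local Notation T := (rho (1, 0)).

Lemma SLrep_unit g : rho g \is a GRing.unit.
Proof. by case: rhoP => rdet _; rewrite unitmxE rdet unitr1. Qed.

Lemma SLrep_one : rho (0, 0) = 1.
Proof.
case: rhoP => _ rhoM; apply: (mulrI (SLrep_unit (0, 0))).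
by rewrite mulr1 -mulmxE -rhoM ZltimesH_mulE scaler0 !addr0.
Qed.

Lemma SLrepE g : rho g = T ^ g.1 *m rho (0, g.2).
Proof.
case: rhoP => _ rhoM; case: g => z h /=.
have rhoX k : rho (k%:Z, 0) = T ^+ k.
  elim: k => [|k IHk]; first by rewrite SLrep_one expr0.
  rewrite exprS -IHk -mulmxE -rhoM.
  by rewrite ZltimesH_mulE scaler0 addr0 -PoszD.
have -> : T ^ z = rho (z, 0).
  case: z => k; first by rewrite rhoX.
  rewrite NegzE -exprnN -rhoX.
  apply: (mulrI (SLrep_unit (k.+1%:Z, 0))); rewrite divrr ?SLrep_unit //.
  rewrite -mulmxE -rhoM -SLrep_one.
  by rewrite ZltimesH_mulE scaler0 addr0 addrN.
rewrite -rhoM.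
by rewrite ZltimesH_mulE scaler0 add0r addr0.
Qed.

Lemma SLrepD h1 h2 : rho (0, h1 + h2) = rho (0, h1) *m rho (0, h2).
Proof.
case: rhoP => _ rhoM; rewrite -rhoM.
by rewrite ZltimesH_mulE addr0 expr0z scale1r.
Qed.

Lemma SLrep_shift k h : rho (0, h) *m T ^+ k = T ^+ k *m rho (0, t ^+ k *: h).
Proof.
case: rhoP => _ rhoM.
have rhoX : rho (k%:Z, 0) = T ^+ k by rewrite SLrepE SLrep_one mulmxE mulr1.
rewrite -[RHS](SLrepE (k%:Z, _)) -rhoX -rhoM.
by rewrite ZltimesH_mulE add0r addr0.
Qed.

Lemma SLrep_weight_vector : exists (chi : H -> R[i]) (v : 'cV_m.+1),
  [/\ is_character chi, v != 0 & forall h, rho (0, h) *m v = chi h *: v].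
Proof.
have [||v v0 /choice[chi chiE]] :=
  @commuting_family_eigenvector _ m.+1 H (fun h => rho (0, h)).
- by [].
- by move=> h1 h2; rewrite -!SLrepD addrC.
exists chi, v; split=> //; split=> [h|h1 h2].
  apply: contraNneq v0 => chi0.
  by rewrite -(mulKmx (SLrep_unit (0, h)) v) chiE chi0 scale0r mulmx0.
have : (chi (h1 + h2) - chi h1 * chi h2) *: v == 0.
  rewrite scalerBl -chiE SLrepD -mulmxA chiE -scalemxAr chiE scalerA.
  by rewrite [chi h2 * _]mulrC subrr.
by rewrite scaler_eq0 (negPf v0) orbF subr_eq0 => /eqP.
Qed.

Definition orbit_mx k (v : 'cV[R[i]]_m.+1) : 'M_(m.+1, k) :=
  \matrix_(i < m.+1, j < k) (T ^+ j *m v) i 0.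

Lemma col_orbit_mx k v j : col j (orbit_mx k v) = T ^+ j *m v.
Proof. by apply/colP => i; rewrite !mxE. Qed.

(** By [SLrep_shift], T^j v has weight t^j chi when [v] has weight chi. *)
Lemma orbit_mx_weight k chi v : (forall h, rho (0, h) *m v = chi h *: v) ->
  forall h, rho (0, h) *m orbit_mx k v = orbit_mx k v *m weight_mx k chi h.
Proof.
move=> vchi h; apply/trmx_inj/row_matrixP => j; rewrite -!tr_col; congr (_^T).
rewrite [LHS]colE -mulmxA -colE col_orbit_mx mulmxA SLrep_shift -mulmxA vchi.
by apply/colP => i; rewrite -scalemxAr mul_mx_diag !mxE mulrC.
Qed.

Lemma orbit_mx_free k chi v : is_character chi ->
    (forall l, (0 < l < k)%N -> ~ factors_through l chi) -> v != 0 ->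
    (forall h, rho (0, h) *m v = chi h *: v) ->
  row_free (orbit_mx k v)^T.
Proof.
move=> chiC nfact v0 vchi.
apply: (@eigenvectors_free _ _ _ _ _ (fun h => rho (0, h)) _ (shift_inj chiC nfact)).
  exact: orbit_mx_weight.
move=> i; rewrite col_orbit_mx; apply: contraNneq v0 => Tv.
by rewrite -(mulKmx (unitrX i (SLrep_unit (1, 0))) v) Tv mulmx0.
Qed.

Lemma weight_has_order chi (v : 'cV_m.+1) : is_character chi -> v != 0 ->
  (forall h, rho (0, h) *m v = chi h *: v) -> exists k, has_order chi k.+1.
Proof.
move=> chiC v0 vchi.
have ex_l : exists l, (0 < l)%N && `[< factors_through l chi >].
  apply: contrapT => /forallNP nl.
  (* Without any period, m + 2 vectors would be independent in dimension m + 1. *)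
  have : row_free (orbit_mx m.+2 v)^T.
    apply: orbit_mx_free chiC _ v0 vchi => l /andP[l_gt0 _] lchi.
    by apply: (nl l); rewrite l_gt0; apply/asboolP.
  by move/eqP=> rk; have := rank_leq_col (orbit_mx m.+2 v)^T; rewrite rk ltnn.
case: (ex_minnP ex_l) => [[|k] //= /asboolP kchi kmin].
exists k; split=> // l l_gt0 lchi; apply: kmin; rewrite l_gt0.
exact/asboolP.
Qed.

End WeightVectors.

(** * Classification of the irreducible representations *)

Lemma irreducible_SLrepP n (rho : ZltimesH H -> 'M[R[i]]_n) :
    is_SLrep rho -> irreducible_rep rho ->
  exists chi : H -> R[i],
    [/\ is_character chi, has_order chi n & conjugate_rep rho (alpha n chi)].
Proof.
case: n rho => [|m] rho rhoP [// _ rho_irr].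
have [chi [v [chiC v0 vchi]]] := SLrep_weight_vector rhoP.
have [k chik] := weight_has_order rhoP chiC v0 vchi.
have [_ /factors_throughP-/(_ chiC) chit chi_min] := chik.
pose T := rho (1, 0); have uT : T \is a GRing.unit := SLrep_unit rhoP _.
have [c [w [wchi w0 Tw]]] : exists c (w : 'cV_m.+1),
    [/\ forall h, rho (0, h) *m w = chi h *: w, w != 0 & T ^+ k.+1 *m w = c *: w].
  (* The weight space of [chi] is stable under T^(k+1) because t^(k+1) chi = chi. *)
  pose P (u : 'cV_m.+1) := forall h, rho (0, h) *m u = chi h *: u.
  apply: (@stable_eigenvector _ _ (T ^+ k.+1) P v) => //.
    move=> a u1 u2 chi1 chi2 h.
    by rewrite mulmxDr -scalemxAr chi1 chi2 scalerDr !scalerA mulrC.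
  by move=> u uchi h; rewrite mulmxA SLrep_shift // -mulmxA uchi chit -scalemxAr.
have c0 : c != 0.
  apply: contraNneq w0 => c0.
  by rewrite -(mulKmx (unitrX k.+1 uT) w) Tw c0 scale0r mulmx0.
pose V := orbit_mx rho k.+1 w; pose C := cycle_mx k c.
have TV : T *m V = V *m C by exact: power_cols_cycle.
have uC : C \is a GRing.unit by exact: cycle_mx_unit.
(* Used twice: it makes the column span of [V] a subrepresentation, and once [V] is square and
   invertible it is the conjugacy. *)
have rhoV g : rho g *m V = V *m (C ^ g.1 *m weight_mx k.+1 chi g.2).
  rewrite SLrepE // -mulmxA (orbit_mx_weight rhoP k.+1 wchi) !mulmxA.
  by rewrite (intertwine_exprz g.1 uT uC TV).
have Vfree : row_free V^T.
  apply: orbit_mx_free wchi => // l /andP[l_gt0 ltl] /(chi_min _ l_gt0).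
  by rewrite leqNgt ltl.
have lekm : (k.+1 <= m.+1)%N by rewrite -(eqP Vfree) rank_leq_col.
pose f : 'Hom('cV[R[i]]_k.+1, 'cV[R[i]]_m.+1) := linfun (mulmx V).
have fE u : f u = V *m u by rewrite lfunE.
have Vw : V *m delta_mx ord0 0 = w by rewrite -colE col_orbit_mx expr0 mul1mx.
have fullV : limg f = fullv.
  case: (rho_irr (limg f)) => // [g _ /memv_imgP[u _ ->]|V0].
    by rewrite fE mulmxA rhoV -mulmxA -fE memv_img // memvf.
  have : w \in limg f by rewrite -Vw -fE memv_img // memvf.
  by rewrite V0 memv0 (negPf w0).
have lemk : (m.+1 <= k.+1)%N.
  have := limg_ker_dim f fullv; rewrite fullV !dimvf /dim /= !muln1 => <-.
  exact: leq_addl.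
have [km] : k.+1 = m.+1 by apply/eqP; rewrite eqn_leq lekm.
subst k.
have uV : V \in unitmx by rewrite -unitmx_tr -row_free_unit.
(* Determinants in [TV] give 1 = det C = (-1)^m c. *)
have cE : c = (-1) ^+ m.
  have [rho_det _] := rhoP.
  have : \det C = 1.
    apply: (mulfI (x := \det V)); first by rewrite -unitfE -unitmxE.
    by rewrite -det_mulmx -TV det_mulmx rho_det mul1r mulr1.
  rewrite det_cycle_mx => /(congr1 ( *%R ((-1) ^+ m))).
  by rewrite mulrA -expr2 sqrr_sign mul1r mulr1.
exists chi; split=> //; exists V => // g.
by rewrite alphaE cyclic_mxE -cE -rhoV mulmxK.
Qed.

End CyclicRepresentation.

Theorem theorem3p3 (R : realType) (H : lmodType laurent) (n : nat)
    (H_fg : finitely_generated H)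
    (H_iso : bijective (fun h : H => (laurentX - 1) *: h))
    (n_gt0 : (0 < n)%N) :
  [/\ (forall chi : H -> R[i], is_character chi -> has_order chi n ->
         is_SLrep (alpha n chi) /\ irreducible_rep (alpha n chi)),
      (forall chi1 chi2 : H -> R[i],
         is_character chi1 -> has_order chi1 n ->
         is_character chi2 -> has_order chi2 n ->
         (conjugate_rep (alpha n chi1) (alpha n chi2) <->
          exists k : int, chi1 = char_shift k chi2))
    & (forall rho : ZltimesH H -> 'M[R[i]]_n,
         is_SLrep rho -> irreducible_rep rho ->
         exists chi : H -> R[i],
           [/\ is_character chi, has_order chi n
             & conjugate_rep rho (alpha n chi)])].
Proof.
split=> [chi chiC chin|chi1 chi2 chi1C chi1n chi2C chi2n|rho].
- by split; [exact: alpha_SLrep | exact: alpha_irreducible].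
- exact: alpha_conjugateP.
- exact: irreducible_SLrepP.
Qed.
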